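(* If the Kolakoski sequence $S$ is recurrent, then $S$ is reversal invariant.
   Context: Words are over the alphabet $\{1,2\}$. For a finite or infinite word $v=a_1a_2\cdots$, its integral $v^{-1}$ is obtained by replacing each letter $a_i$ by $a_i$ copies of the letter $1$ if $i$ is odd and by $a_i$ copies of the letter $2$ if $i$ is even. The Kolakoski sequence $S=1221121221\cdots$ is the unique infinite word over $\{1,2\}$ with $S^{-1}=S$. $S$ is recurrent if every finite subword of $S$ occurs at least twice in $S$. The reversal of $v=a_1\cdots a_n$ is $a_na_{n-1}\cdots a_1$; $S$ is reversal invariant if the set of its finite subwords is closed under reversal. *)

(* Defs.v *)
From mathcomp Require Import all_boot.

Set Implicit Arguments.
Unset Strict Implicit.
Unset Printing Implicit Defensive.

Inductive letter := L1 | L2.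

Definition letter_nat (a : letter) : nat := if a is L1 then 1 else 2.
Coercion letter_nat : letter >-> nat.

Definition infword := nat -> letter.

(* Positions are numbered from 0 here, so the runs of 1 in an integral are the
   ones of even index. *)
Definition run_letter (i : nat) : letter := if odd i then L2 else L1.

Definition integral (v : seq letter) : seq letter :=
  flatten (mkseq (fun i => nseq (nth L1 v i) (run_letter i)) (size v)).

(* Each run is nonempty, so the letter at position n of the integral of an
   infinite word is already determined by its first n + 1 letters; see
   [inf_integral_prefix]. *)
Definition inf_integral (w : infword) : infword :=
  fun n => nth L1 (integral (mkseq w n.+1)) n.

Definition kolakoski (S : infword) : Prop := inf_integral S =1 S.

Definition occurs_at (u : seq letter) (S : infword) (i : nat) : Prop :=
  mkseq (fun j => S (i + j)) (size u) = u.

Definition subword (u : seq letter) (S : infword) : Prop :=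
  exists i, occurs_at u S i.

Definition recurrent (S : infword) : Prop :=
  forall u, subword u S -> exists i j, [/\ i <> j, occurs_at u S i & occurs_at u S j].

Definition reversal_invariant (S : infword) : Prop :=
  forall u, subword u S -> subword (rev u) S.

Lemma integral_rcons v a :
  integral (rcons v a) = integral v ++ nseq a (run_letter (size v)).
Proof.
rewrite /integral size_rcons mkseqS flatten_rcons nth_rcons ltnn eqxx.
congr (flatten _ ++ _).
by apply/eq_in_map => i; rewrite mem_iota nth_rcons => /= ->.
Qed.

Lemma integral_cat_prefix v u : exists t, integral (v ++ u) = integral v ++ t.
Proof.
elim/last_ind: u => [|u a [t Ht]]; first by exists [::]; rewrite !cats0.
by rewrite -rcons_cat integral_rcons Ht -catA; eexists.
Qed.

Lemma size_integral v : size v <= size (integral v).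
Proof.
elim/last_ind: v => // v a IH.
rewrite integral_rcons size_cat size_nseq size_rcons -addn1.
by apply: leq_add => //; case: a.
Qed.

Lemma mkseq_split (w : infword) m n : m <= n ->
  exists t, mkseq w n = mkseq w m ++ t.
Proof.
by move=> le; rewrite /mkseq -(subnKC le) iotaD map_cat; eexists.
Qed.

Lemma nth_integral_mono (w : infword) m n k : m <= n ->
  k < size (integral (mkseq w m)) ->
  nth L1 (integral (mkseq w n)) k = nth L1 (integral (mkseq w m)) k.
Proof.
move=> le lt; have [t ->] := mkseq_split w le.
by have [s ->] := integral_cat_prefix (mkseq w m) t; rewrite nth_cat lt.
Qed.

Lemma inf_integral_prefix (w : infword) n :
  mkseq (inf_integral w) (size (integral (mkseq w n))) = integral (mkseq w n).
Proof.
apply: (@eq_from_nth _ L1); rewrite size_mkseq // => k lt.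
rewrite nth_mkseq // /inf_integral.
case: (leqP n k.+1) => [le|/ltnW le]; first by rewrite (nth_integral_mono le).
rewrite -(nth_integral_mono le) //.
by apply: leq_trans (size_integral _); rewrite size_mkseq.
Qed.

Lemma size_integral12 v : size v + 2 < size (integral [:: L1, L2 & v]).
Proof.
elim/last_ind: v => // v a IH.
rewrite -!rcons_cons integral_rcons size_cat size_nseq size_rcons addSn -addn1.
by apply: leq_add => //; case: a.
Qed.

Lemma kolakoski_unique S T : kolakoski S -> kolakoski T -> S =1 T.
Proof.
have H0 R : kolakoski R -> R 0 = L1.
  by move=> /(_ 0) <-; rewrite /inf_integral /integral /=; case: (R 0).
have H1 R : kolakoski R -> R 1 = L2.
  move=> kR; rewrite -kR /inf_integral /integral /= (H0 _ kR) /=.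
  by case: (R 1).
have Hn R n : kolakoski R -> R n.+2 = nth L1 (integral (mkseq R n.+2)) n.+2.
  move=> kR; rewrite -{1}kR /inf_integral; apply: nth_integral_mono => //.
  have [t Et] := mkseq_split R (isT : 2 <= n.+2).
  have Es : size t = n.
    by move/(congr1 size): Et; rewrite size_mkseq /= => -[].
  rewrite Et /= (H0 _ kR) (H1 _ kR) -Es -addn2.
  exact: size_integral12.
move=> kS kT; elim/ltn_ind => -[|[|n]] IH; rewrite ?(H0 S) ?(H0 T) ?(H1 S) ?(H1 T) //.
rewrite (Hn S) // (Hn T) //; congr (nth _ (integral _) _).
by apply/eq_in_map => i; rewrite mem_iota => /andP[_]; apply: IH.
Qed.

Lemma kolakoski_exists : exists S, kolakoski S.
Proof.
pose W n := iter n integral [:: L1; L2].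
have WS n : W n.+1 = integral (W n) by [].
have Wstep n : exists t, W n.+1 = W n ++ t.
  elim: n => [|n [t Ht]]; first by exists [:: L2].
  rewrite WS {1}Ht (WS n); exact: integral_cat_prefix.
have Wle m n : m <= n -> exists t, W n = W m ++ t.
  move=> /subnKC <-; elim: (n - m) => [|k [t Ht]].
    by exists [::]; rewrite addn0 cats0.
  by rewrite addnS; have [s ->] := Wstep (m + k); rewrite Ht -catA; eexists.
have Wsize n : n < size (W n).
  elim: n => // n IH.
  have [t Ht] := Wle 0 n (leq0n n).
  rewrite WS; apply: leq_ltn_trans IH _.
  by rewrite Ht /= -addn2; exact: size_integral12.
pose S : infword := fun n => nth L1 (W n) n.
have SW n k : k < size (W n) -> S k = nth L1 (W n) k.
  move=> lt; rewrite /S; case: (leqP n k) => [|/ltnW] /Wle[t ->].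
    by rewrite nth_cat lt.
  by rewrite nth_cat Wsize.
exists S => n; rewrite /inf_integral.
have E : mkseq S n.+1 = take n.+1 (W n).
  apply: (@eq_from_nth _ L1); first by rewrite size_mkseq size_takel.
  rewrite size_mkseq => k lt; rewrite nth_mkseq // nth_take // (SW n) //.
  exact: leq_trans lt (Wsize n).
have [t Ht] := integral_cat_prefix (take n.+1 (W n)) (drop n.+1 (W n)).
rewrite (SW n.+1); last exact: ltnW.
rewrite WS -[in RHS](cat_take_drop n.+1 (W n)) Ht E nth_cat.
suff -> : n < size (integral (take n.+1 (W n))) by [].
by apply: leq_trans (size_integral _); rewrite size_takel.
Qed.

(* Main.v *)
Require Import Defs.
From mathcomp Require Import all_boot.
From mathcomp Require Import zify.

Set Implicit Arguments.
Unset Strict Implicit.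
Unset Printing Implicit Defensive.

(** A long prefix of [S] that occurs at a position [i > 0] starts a run there,
    since otherwise the run lengths of [S] would contain 222.  Hence the run
    lengths from that point on again show a prefix of [S] at a position [j > 0].
    Inductively the letters before [j] mirror the letters after the beginning of
    [S], and integrating gives the same for [i], on a longer stretch: [i] is the
    centre of a palindrome whose right half is a prefix of [S].  Recurrence
    supplies such an [i] for every length. *)

(** For a Kolakoski sequence, which lists its own run lengths, this is the position where run [n]
    begins. *)
Definition run_start (S : infword) (n : nat) : nat := \sum_(t < n) S t.

Lemma letter_nat_gt0 (a : letter) : 0 < a.
Proof. by case: a. Qed.

Lemma letter_nat_le2 (a : letter) : a <= 2.
Proof. by case: a. Qed.

Lemma run_letterS n : run_letter n.+1 <> run_letter n.
Proof. by rewrite /run_letter /=; case: odd. Qed.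

Lemma run_start0 (S : infword) : run_start S 0 = 0.
Proof. by rewrite /run_start big_ord0. Qed.

Lemma run_startS (S : infword) n : run_start S n.+1 = run_start S n + S n.
Proof. by rewrite /run_start big_ord_recr. Qed.

Lemma leq_run_start (S : infword) m n : m <= n -> run_start S m <= run_start S n.
Proof.
move=> /subnKC <-; elim: (n - m) => [|d IH]; first by rewrite addn0.
by rewrite addnS run_startS; apply: leq_trans IH (leq_addr _ _).
Qed.

Lemma size_integral_mkseq (S : infword) n : size (integral (mkseq S n)) = run_start S n.
Proof.
elim: n => [|n IH]; first by rewrite run_start0.
by rewrite mkseqS integral_rcons size_cat size_nseq IH run_startS.
Qed.

Lemma run_start_locate (S : infword) i :
  exists n r, r < S n /\ i = run_start S n + r.
Proof.
elim: i => [|i [n [r [lt ->]]]].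
  by exists 0, 0; rewrite run_start0 letter_nat_gt0.
case: (ltnP r.+1 (S n)) => [lt'|ge]; first by exists n, r.+1; split=> //; lia.
by exists n.+1, 0; rewrite letter_nat_gt0 run_startS; split=> //; lia.
Qed.

Section Kolakoski.

Variables (S : infword) (kS : kolakoski S).

Lemma kolakoski_run n r : r < S n -> S (run_start S n + r) = run_letter n.
Proof.
move=> lt; have := inf_integral_prefix S n.+1.
move/(congr1 (fun s => nth L1 s (run_start S n + r))).
rewrite size_integral_mkseq nth_mkseq ?run_startS ?ltn_add2l // kS => ->.
rewrite mkseqS integral_rcons nth_cat size_integral_mkseq ltnNge leq_addr /=.
by rewrite addKn size_mkseq nth_nseq lt.
Qed.

Lemma kolakoski_run_start n : S (run_start S n) = run_letter n.
Proof. by rewrite -[run_start S n]addn0 kolakoski_run ?letter_nat_gt0. Qed.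

Lemma kolakoski_run_length n :
  S n = L2 <-> S (run_start S n).+1 = run_letter n.
Proof.
split=> [E|]; first by rewrite -addn1 kolakoski_run ?E.
case E: (S n) => //.
have -> : (run_start S n).+1 = run_start S n.+1 by rewrite run_startS E addn1.
by rewrite kolakoski_run_start => /run_letterS.
Qed.

Lemma kolakoski_prefix6 : mkseq S 6 = [:: L1; L2; L2; L1; L1; L2].
Proof.
have s0 := run_start0 S.
have S0 : S 0 = L1 by rewrite -{1}s0 kolakoski_run_start.
have s1 : run_start S 1 = 1 by rewrite run_startS s0 S0.
have S1 : S 1 = L2 by rewrite -{1}s1 kolakoski_run_start.
have s2 : run_start S 2 = 3 by rewrite run_startS s1 S1.
have S2 : S 2 = L2 by have := @kolakoski_run 1 1; rewrite s1 S1; apply.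
have s3 : run_start S 3 = 5 by rewrite run_startS s2 S2.
have S3 : S 3 = L1 by rewrite -{1}s2 kolakoski_run_start.
have S4 : S 4 = L1 by have := @kolakoski_run 2 1; rewrite s2 S2; apply.
have S5 : S 5 = L2 by rewrite -{1}s3 kolakoski_run_start.
by rewrite /mkseq /= S0 S1 S2 S3 S4 S5.
Qed.

(** Runs have length at most 2, so the run after the one containing [n] begins at [n + 1] or
    [n + 2], with the other letter. *)
Lemma kolakoski_no_cube n : S n = S n.+1 -> S n.+1 <> S n.+2.
Proof.
have [m [r [lt En]]] := run_start_locate S n.
move=> E1 E2; have Sn : S n = run_letter m by rewrite En kolakoski_run.
apply: (@run_letterS m); rewrite -Sn -kolakoski_run_start run_startS.
have le2 := letter_nat_le2 (S m).
have [->|->] : run_start S m + S m = n.+1 \/ run_start S m + S m = n.+2 by lia.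
- by [].
- by rewrite E1 E2.
Qed.

Lemma kolakoski_prefix_run_start i : 0 < i ->
  (forall t, t < 6 -> S (i + t) = S t) ->
  exists j, [/\ 0 < j, ~~ odd j & i = run_start S j].
Proof.
move=> i0 H.
have [n [r [lt Ei]]] := run_start_locate S i.
case: kolakoski_prefix6 => S0 S1 S2 S3 S4 S5.
have On : ~~ odd n.
  have := H 0 isT; rewrite addn0 {1}Ei kolakoski_run // S0 /run_letter.
  by case: odd.
case: r lt Ei => [|r] lt Ei.
  exists n; split=> //; last by rewrite Ei addn0.
  by case: n {lt On} Ei => // Ei; rewrite Ei run_start0 in i0.
(* Here [i] would be the second letter of run [n]; the 22 and 11 that follow in the prefix then make
   runs [n + 1] and [n + 2] have length 2 as well. *)
have Sn : S n = L2 by move: lt; case: (S n).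
have r0 : r = 0 by move: lt; rewrite Sn; case: r {Ei}.
have Es1 : run_start S n.+1 = i + 1 by rewrite run_startS Sn Ei r0 -addnA.
have Sn1 : S n.+1 = L2.
  apply/kolakoski_run_length; rewrite Es1 -addnS H // S2.
  by rewrite /run_letter /= On.
have Es2 : run_start S n.+2 = i + 3 by rewrite run_startS Sn1 Es1 -addnA.
have Sn2 : S n.+2 = L2.
  apply/kolakoski_run_length; rewrite Es2 -addnS H // S4.
  by rewrite /run_letter /= negbK (negbTE On).
by case: (@kolakoski_no_cube n); rewrite ?Sn ?Sn1 ?Sn2.
Qed.

(** As [j] is even, runs [j + t] and [t] consist of the same letter. Once their starts are aligned,
    the letter after the start tells whether each has length 2; equal lengths align the next starts,
    hence the joint induction. *)
Lemma kolakoski_prefix_derive j M : ~~ odd j ->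
  (forall s, s <= run_start S M -> S (run_start S j + s) = S s) ->
  forall t, t <= M ->
    run_start S (j + t) = run_start S j + run_start S t /\
    (t < M -> S (j + t) = S t).
Proof.
move=> Oj H.
have step t : run_start S (j + t) = run_start S j + run_start S t ->
    t < M -> S (j + t) = S t.
  move=> E lt.
  have le : (run_start S t).+1 <= run_start S M.
    apply: leq_trans (leq_run_start S lt); rewrite run_startS -addn1 leq_add2l.
    exact: letter_nat_gt0.
  have W : S (j + t) = L2 <-> S t = L2.
    rewrite !kolakoski_run_length E -addnS H //.
    by rewrite /run_letter oddD (negbTE Oj).
  by move: W; case: (S t) (S (j + t)) => -[] // [] // A B;
    (have // := A erefl) || have // := B erefl.
elim=> [|t IH] le.
  by have E : run_start S (j + 0) = run_start S j + run_start S 0;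
    [rewrite addn0 run_start0 addn0 | split=> //; apply: step].
have [E /(_ le) Et] := IH (ltnW le).
have E' : run_start S (j + t.+1) = run_start S j + run_start S t.+1.
  by rewrite addnS !run_startS E Et addnA.
by split=> //; apply: step.
Qed.

(** The letter 2 at position 1 makes integration strictly lengthen a prefix, which lets the
    palindrome grow. *)
Lemma ltn_run_start n : 1 < n -> n < run_start S n.
Proof.
case: kolakoski_prefix6 => S0 S1 _ _ _ _.
elim: n => // -[|n] // IH _; rewrite run_startS.
case: n IH => [|n] IH; first by rewrite !run_startS run_start0 S0 S1.
by have := IH isT; have := letter_nat_gt0 (S n.+2); lia.
Qed.

(** Runs [j - q] and [q] have equal lengths by the mirror hypothesis and equal letters because [j]
    is even. Run [j] is the single letter at the centre, whence the successor. *)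
Lemma kolakoski_integrate_mirror k j : k <= j -> ~~ odd j ->
  (forall t, t <= k -> S (j - t) = S t) ->
  forall q, q <= k ->
    (run_start S j).+1 = run_start S (j - q) + run_start S q.+1 /\
    forall r, r < S q ->
      S (run_start S j - (run_start S q + r)) = S (run_start S q + r).
Proof.
move=> kj Oj H.
case: kolakoski_prefix6 => S0 _ _ _ _ _.
have E q : q <= k ->
    (run_start S j).+1 = run_start S (j - q) + run_start S q.+1.
  elim: q => [|q IH] le; first by rewrite subn0 run_startS run_start0 S0 add0n addn1.
  rewrite (IH (ltnW le)) [in RHS]run_startS.
  have -> : j - q = (j - q.+1).+1 by lia.
  by rewrite (run_startS S (j - q.+1)) H //; lia.
move=> q le; split=> [|r lt]; first exact: E.
(* Reflection reverses a run, sending offset [r] to [S q - r.+1]. *)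
have lt' : S q - r.+1 < S (j - q) by rewrite H //; lia.
rewrite (kolakoski_run lt).
have := E q le; rewrite run_startS => Eq.
have -> : run_start S j - (run_start S q + r) =
          run_start S (j - q) + (S q - r.+1) by lia.
by rewrite kolakoski_run // /run_letter oddB ?(negbTE Oj) //; lia.
Qed.

Lemma kolakoski_prefix_mirror k : exists N, forall i, 0 < i ->
  (forall t, t < N -> S (i + t) = S t) ->
  k <= i /\ forall t, t <= k -> S (i - t) = S t.
Proof.
case: kolakoski_prefix6 => S0 S1 _ _ _ _.
elim: k => [|k [N IH]].
  exists 1 => i i0 H; split=> // t.
  by rewrite leqn0 => /eqP ->; rewrite subn0 -[in LHS](addn0 i) H.
(* Six letters force [i] to start a run; the other bound yields [N] matching letters at [j], as the
   induction hypothesis requires. *)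
exists (maxn 6 (run_start S N).+1) => i i0 H.
have [j [j0 Oj Ei]] : exists j, [/\ 0 < j, ~~ odd j & i = run_start S j].
  apply: kolakoski_prefix_run_start => // t lt.
  by apply: H; rewrite leq_max lt.
have Hj t : t < N -> S (j + t) = S t.
  move=> lt; apply: (proj2 (@kolakoski_prefix_derive j N Oj _ t (ltnW lt))) => //.
  by move=> s le; rewrite -Ei H // leq_max orbC ltnS le.
have [kj Hk] := IH j j0 Hj.
case: k IH kj Hk => [|k] IH kj Hk.
  (* Radius 0 integrates to radius 0 only, since [S 0] is 1, so radius 1 is checked directly: the
     letter before [i] ends a run of odd index, hence is 2. *)
  split=> // -[|[|t]] // _; first by rewrite subn0 -[in LHS](addn0 i) H // leq_max.
  case: j j0 Oj Ei {Hj kj Hk} => // j _ Oj ->.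
  rewrite S1 run_startS; have l0 := letter_nat_gt0 (S j).
  have -> : run_start S j + S j - 1 = run_start S j + (S j - 1) by lia.
  rewrite kolakoski_run; last by lia.
  by move: Oj; rewrite /run_letter /= negbK => ->.
have M := @kolakoski_integrate_mirror _ _ kj Oj Hk.
have lk : k.+2 < run_start S k.+2 by apply: ltn_run_start.
split; first by have [E _] := M k.+1 (leqnn _); lia.
move=> t le; have [q [r [lt Et]]] := run_start_locate S t.
have qk : q <= k.+1.
  by rewrite leqNgt; apply/negP => /(@leq_run_start S); lia.
by rewrite Ei Et; apply: (proj2 (M q qk)).
Qed.

End Kolakoski.

Theorem theorem3 (S : infword) :
  kolakoski S -> recurrent S -> reversal_invariant S.
Proof.
move=> kS rS u [p Hp].
have [N HN] := @kolakoski_prefix_mirror S kS (p + size u).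
have [i i0 Hi] : exists2 i, 0 < i & forall t, t < N -> S (i + t) = S t.
  have [|i [j [ne oi oj]]] := rS (mkseq S N).
    by exists 0; rewrite /occurs_at size_mkseq.
  have occ l : occurs_at (mkseq S N) S l -> forall t, t < N -> S (l + t) = S t.
    move=> o t lt; move/(congr1 (fun s => nth L1 s t)): o.
    by rewrite size_mkseq !nth_mkseq.
  (* Of two distinct occurrences of the prefix, at least one is not at 0. *)
  case: i ne oi => [|i] ne oi; last by exists i.+1 => //; apply: occ.
  by exists j; [case: j ne {oj} | apply: occ].
have [le mirror] := HN i i0 Hi.
have Hu t : t < size u -> nth L1 u t = S (p + t).
  by move=> lt; rewrite -{1}Hp nth_mkseq.
(* Reflected in [i], the end [p + size u - 1] of [u] becomes the start of its reversal. *)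
exists (i.+1 - (p + size u)); rewrite /occurs_at size_rev.
apply: (@eq_from_nth _ L1); rewrite size_mkseq ?size_rev // => s lt.
rewrite nth_mkseq // nth_rev // Hu; last by lia.
rewrite -[in RHS]mirror; last by lia.
by congr S; lia.
Qed.
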